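(* For every real $s>2$, each of the following two assertions fails already for $3\times3$ positive definite complex matrices: (i) (Conjecture 3.2 of Shi--Wei--Wang) for every nonnegative nondecreasing function $f$ on an interval containing $\operatorname{spec}(A)$, \[ \operatorname{Tr} f(A)A^sB^s\geq \operatorname{Tr} f(A)(A^{1/2}BA^{1/2})^s ; \] (ii) (Conjecture 3.3 of Shi--Wei--Wang) for every function $g$ on an interval containing $\operatorname{spec}(A)$ such that $x\mapsto x^sg(x)$ is nonnegative and nonincreasing, \[ \operatorname{Tr} g(A)(A^{1/2}BA^{1/2})^s\geq \operatorname{Tr} g(A)A^sB^s . \] That is, for every $s>2$ there exist positive definite $A,B\in M_3(\mathbb C)$ and $f$ as in (i) violating the inequality in (i), and there exist positive definite $A,B\in M_3(\mathbb C)$ and $g$ as in (ii) violating the inequality in (ii).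
   Context: Powers and functions of Hermitian matrices are taken by the functional calculus; $\operatorname{spec}(A)$ is the set of eigenvalues of $A$. For the function $g$ with positive definite $A$, the interval may be taken inside $(0,\infty)$. *)

(* Defs.v *)
From HB Require Import structures.
From mathcomp Require Import all_boot all_order all_algebra.
From mathcomp Require Import spectral sesquilinear.
From mathcomp Require Import complex.
From mathcomp Require Import boolp classical_sets reals exp.

Set Implicit Arguments.
Unset Strict Implicit.
Unset Printing Implicit Defensive.

Import Order.TTheory GRing.Theory Num.Theory.
Local Open Scope ring_scope.
Local Open Scope complex_scope.
Local Open Scope sesquilinear_scope.
Local Open Scope classical_set_scope.

(* [0 < z] on [R[i]] means that z is a positive real number. *)
Definition posdefmx (R : realType) (n : nat) (A : 'M[R[i]]_n) : Prop :=
  A \is hermsymmx /\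
  forall u : 'cV[R[i]]_n, u != 0 -> 0 < (u ^t* *m A *m u) 0 0.

Definition spec (R : realType) (n : nat) (A : 'M[R[i]]_n) : set R[i] :=
  [set z | eigenvalue A z].

(* Functional calculus f(A) = P^* diag(f(d_i)) P, where A = P^* diag(d) P with
   P unitary. It is only meaningful for Hermitian A, whose eigenvalues d_i are
   real; [hermfunE] shows that it does not depend on the diagonalization. *)
Definition hermfun (R : realType) (n : nat) (f : R -> R) (A : 'M[R[i]]_n) :
    'M[R[i]]_n :=
  (spectralmx A) ^t*
    *m diag_mx (\row_j (f (complex.Re (spectral_diag A 0 j)))%:C)
    *m spectralmx A.

(* A^s for positive definite A: [powR] is the usual power on positive reals,
   but takes conventional values elsewhere. *)
Definition hermpow (R : realType) (n : nat) (A : 'M[R[i]]_n) (s : R) :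
    'M[R[i]]_n :=
  hermfun (fun x => x `^ s) A.

Lemma hermfunE (R : realType) (n : nat) (f : R -> R) (U : 'M[R[i]]_n)
    (d : 'rV[R]_n) :
  U \is unitarymx ->
  hermfun f (U ^t* *m diag_mx (\row_j (d 0 j)%:C) *m U) =
  U ^t* *m diag_mx (\row_j (f (d 0 j))%:C) *m U.
Proof.
move=> Uu; set E := diag_mx _; set A := _ *m U.
have UUt : U *m U ^t* = 1%:M by apply/unitarymxP.
have UtU : U ^t* *m U = 1%:M by apply: mulmx1C.
have cE : E ^t* = E.
  apply/matrixP=> i j; rewrite !mxE eq_sym; case: eqVneq => [->|_] /=.
    by rewrite !mulr1n; apply: conjc_real.
  by rewrite !mulr0n rmorph0.
have hA : A \is hermsymmx.
  apply/is_hermitianmxP; rewrite expr0 scale1r /A !trmx_mul !map_mxM /=.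
  by rewrite trmxCK cE mulmxA.
have nA := hermitian_normalmx hA.
rewrite /hermfun; set P := spectralmx A; set D := spectral_diag A.
have Pu : P \is unitarymx by apply: spectral_unitarymx.
have PPt : P *m P ^t* = 1%:M by apply/unitarymxP.
have PtP : P ^t* *m P = 1%:M by apply: mulmx1C.
have eA : A = P ^t* *m diag_mx D *m P.
  by rewrite -invmx_unitary //; apply/orthomx_spectralP.
have [W eW] : exists W, W = P *m U ^t* by exists (P *m U ^t*).
have DW : diag_mx D *m W = W *m E.
  transitivity (P *m A *m U ^t*).
    by rewrite eA eW !mulmxA PPt mul1mx.
  by rewrite /A eW -!mulmxA UUt mulmx1.
set fD := diag_mx _; set fE := diag_mx _.
have fW : fD *m W = W *m fE.
  apply/matrixP => i j; rewrite mul_diag_mx mul_mx_diag !mxE.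
  move/matrixP/(_ i j): DW; rewrite mul_diag_mx mul_mx_diag !mxE mulrC.
  have [->|W0] := eqVneq (W i j) 0.
    by rewrite mulr0 !mul0r.
  by move=> /(mulfI W0) ->; rewrite mulrC.
have -> : P = W *m U by rewrite eW -mulmxA UtU mulmx1.
rewrite -[LHS]mulmxA (mulmxA fD) fW trmx_mul map_mxM /= !mulmxA.
rewrite -(mulmxA (U ^t*) (W ^t*) W) (_ : W ^t* *m W = 1%:M) ?mulmx1 //.
by rewrite eW trmx_mul map_mxM /= trmxCK mulmxA -(mulmxA U (P ^t*) P) PtP mulmx1.
Qed.

(* Main.v *)
(* Take A^(1/2) = 1 + t H, with H = u u^T + eta w w^T and v, w, u a real
   orthonormal basis, and f (resp. g) such that f(A) A^s = v v^T. Writing B =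
   diag b, both trace differences are, up to sign, v^T C^s v - v^T B^s v for
   C = (1 + t H) B (1 + t H), and t has opposite signs in the two assertions: it
   is enough that the derivative at t = 0 be nonzero of the right sign. Since
   H v = 0, this derivative is - sum_(i != j) k_ij v_i v_j H_ij, where k is the
   power gap
     k_ij = s (b_i^s + b_j^s) - (b_i + b_j) (b_i^s - b_j^s) / (b_i - b_j).
   For small eta and u_i = +- v_i it is negative as soon as
   sum_(i != j) k_ij x_i x_j > 0, where x_i = u_i v_i has sum 0. For s > 2 the
   kernel k is indeed not conditionally negative, as the points 1/2, 1, c show
   for c large.

   The expansion of C^s to first order is obtained without differentiating the
   functional calculus: its diagonal entries are squeezed by
   0 <= x^s - b^s - s b^(s-1) (x - b) <= M (x - b)^2, and its off-diagonal
   entries follow from C^s C = C C^s. *)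
Require Import Defs.
From mathcomp Require Import all_boot all_order all_algebra.
From mathcomp Require Import spectral sesquilinear.
From mathcomp Require Import complex.
From mathcomp Require Import boolp classical_sets reals exp.
From mathcomp Require Import ring lra.

Set Implicit Arguments.
Unset Strict Implicit.
Unset Printing Implicit Defensive.

Import Order.TTheory GRing.Theory Num.Theory.
Local Open Scope ring_scope.
Local Open Scope complex_scope.
Local Open Scope sesquilinear_scope.
Local Open Scope classical_set_scope.

(** * Tangent and second-order bounds for real powers *)

Section PowerTangent.
Variable R : realType.
Implicit Types x b r : R.

(** Young's inequality for [x] and [b ^ (r - 1)] with conjugate exponents [r] and [r / (r - 1)],
    multiplied by [r]. *)
Lemma powR_ge_tangent r b x : 1 < r -> 0 <= b -> 0 <= x ->
  b `^ r + r * b `^ (r - 1) * (x - b) <= x `^ r.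
Proof.
move=> r1 b0 x0; have r0 : 0 < r by lra.
have q0 : 0 < r / (r - 1) by apply: divr_gt0; lra.
have := conjugate_powR x0 (powR_ge0 b (r - 1)) r0 q0.
rewrite -powRrM mulrCA mulfV ?mulr1; last by lra.
rewrite -mulrA; have -> : b `^ (r - 1) * (x - b) = x * b `^ (r - 1) - b `^ r.
  by rewrite -(mulr_powRB1 b0 r0); ring.
have -> : r^-1 + (r / (r - 1))^-1 = 1 by field; lra.
move=> /(_ erefl) H.
have : r * (x * b `^ (r - 1)) <= r * (x `^ r / r + b `^ r / (r / (r - 1))).
  by rewrite ler_pM2l.
have -> : r * (x `^ r / r + b `^ r / (r / (r - 1))) = x `^ r + (r - 1) * b `^ r.
  by field; lra.
rewrite mulrBr; lra.
Qed.

(** The tangent at [x] bounds the increment with slope [r x^(r-1)]. Replacing [x] by [b] in that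
    slope costs a Lipschitz constant of the power [r - 1] on [0, N], which the tangent bound for
    that exponent supplies because [r - 1 > 1]. *)
Lemma powR_le_tangent r b N x : 2 < r -> 0 <= b <= N -> 0 <= x <= N ->
  x `^ r <= b `^ r + r * b `^ (r - 1) * (x - b)
            + r * (r - 1) * N `^ (r - 2) * (x - b) ^+ 2.
Proof.
move=> r2 /andP[b0 bN] /andP[x0 xN].
have T1 : x `^ r - b `^ r <= r * x `^ (r - 1) * (x - b).
  have := @powR_ge_tangent r x b ltac:(lra) x0 b0; lra.
suff T2 : (x `^ (r - 1) - b `^ (r - 1)) * (x - b) <=
    (r - 1) * N `^ (r - 2) * (x - b) ^+ 2.
  have : r * ((x `^ (r - 1) - b `^ (r - 1)) * (x - b)) <=
    r * ((r - 1) * N `^ (r - 2) * (x - b) ^+ 2) by rewrite ler_pM2l; lra.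
  move: T1; set X := x `^ (r - 1); set Y := b `^ (r - 1); nra.
have lipschitz y z : 0 <= y -> y <= z -> z <= N ->
    z `^ (r - 1) - y `^ (r - 1) <= (r - 1) * N `^ (r - 2) * (z - y).
  move=> y0 yz zN; have z0 := le_trans y0 yz.
  have := @powR_ge_tangent (r - 1) z y ltac:(lra) z0 y0.
  have -> : r - 1 - 1 = r - 2 by ring.
  have : z `^ (r - 2) <= N `^ (r - 2).
    by apply: ge0_ler_powR => //; rewrite ?nnegrE; lra.
  move: (z `^ (r - 2)) (N `^ (r - 2)) (z `^ (r - 1)) (y `^ (r - 1)) => k l u v.
  move=> kl H.
  have : 0 <= (l - k) * ((r - 1) * (z - y)).
    by apply: mulr_ge0; [|apply: mulr_ge0]; lra.
  by nra.
have [xb|/ltW bx] := leP x b.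
  by have := lipschitz x b x0 xb bN; nra.
by have := lipschitz b x b0 bx xN; nra.
Qed.

End PowerTangent.

(** * Functional calculus through eigenvalues and spectral weights *)

Section HermitianCalculus.
Variables (R : realType) (n : nat).
Implicit Types (A : 'M[R[i]]_n) (f g : R -> R).

Definition eigval A k : R := complex.Re (spectral_diag A 0 k).

(* [weight A k] is the rank one spectral projection of the k-th eigenvalue. *)
Definition weight A k i j : R[i] :=
  (spectralmx A k i)^* * spectralmx A k j.

Lemma hermfun_entry f A i j :
  hermfun f A i j = \sum_k (f (eigval A k))%:C * weight A k i j.
Proof.
rewrite /hermfun mxE; apply: eq_bigr => k _.
by rewrite mul_mx_diag !mxE /weight mulrA; congr (_ * _); rewrite mulrC.
Qed.

Lemma spectralmxK A : spectralmx A *m (spectralmx A) ^t* = 1%:M.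
Proof. by apply/unitarymxP/spectral_unitarymx. Qed.

Lemma hermfunM f g A :
  hermfun f A *m hermfun g A = hermfun (fun x => f x * g x) A.
Proof.
rewrite /hermfun; set P := spectralmx A; set D := diag_mx _; set E := diag_mx _.
have -> : diag_mx (\row_j (f (complex.Re (spectral_diag A 0 j)) *
    g (complex.Re (spectral_diag A 0 j)))%:C) = D *m E.
  rewrite mulmx_diag; congr diag_mx; apply/rowP => j.
  by rewrite !mxE rmorphM.
have PPt : P *m P ^t* = 1%:M := spectralmxK A.
by rewrite !mulmxA -(mulmxA (P ^t* *m D) P) PPt mulmx1.
Qed.

Lemma hermfun1 A : hermfun (fun=> 1) A = 1%:M.
Proof.
rewrite /hermfun (_ : diag_mx _ = 1%:M) ?mulmx1; last first.
  by apply/matrixP => i j; rewrite !mxE.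
exact/mulmx1C/spectralmxK.
Qed.

Lemma hermfun_id A : A \is hermsymmx -> hermfun id A = A.
Proof.
move=> hA; rewrite /hermfun.
have -> : \row_j (complex.Re (spectral_diag A 0 j))%:C = spectral_diag A.
  apply/rowP => j; rewrite mxE; apply: RRe_real.
  exact: (mxOverP (hermitian_spectral_diag_real hA)).
rewrite -(invmx_unitary (spectral_unitarymx A)).
exact/esym/orthomx_spectralP/hermitian_normalmx.
Qed.

Lemma eigvalE A k : A \is hermsymmx ->
  (eigval A k)%:C = (spectralmx A *m A *m (spectralmx A) ^t*) k k.
Proof.
move=> hA; rewrite -{3}(hermfun_id hA) /hermfun !mulmxA spectralmxK mul1mx.
by rewrite -mulmxA spectralmxK mulmx1 !mxE eqxx.
Qed.

Lemma eigval_ge0 A k : A \is hermsymmx ->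
  (forall u : 'cV[R[i]]_n, 0 <= (u ^t* *m A *m u) 0 0) -> 0 <= eigval A k.
Proof.
move=> hA psdA; rewrite -lecR eigvalE //.
have := psdA (col k ((spectralmx A) ^t*)).
have -> : (col k ((spectralmx A) ^t*)) ^t* = row k (spectralmx A).
  by apply/rowP => j; rewrite !mxE; apply: conjCK.
rewrite -row_mul !mxE; under eq_bigr do rewrite !mxE.
by under [X in _ -> _ <= X]eq_bigr do rewrite !mxE.
Qed.

Lemma sum_eigval A : A \is hermsymmx -> (\sum_k eigval A k)%:C = \tr A.
Proof.
move=> hA; rewrite -[in RHS](hermfun_id hA) /hermfun mxtrace_mulC mulmxA.
rewrite spectralmxK mul1mx mxtrace_diag rmorph_sum /=.
by apply: eq_bigr => k _; rewrite mxE.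
Qed.

Lemma eigval_le_tr A k : A \is hermsymmx -> (forall j, 0 <= eigval A j) ->
  eigval A k <= complex.Re (\tr A).
Proof.
move=> hA d0; rewrite -sum_eigval // (bigD1 k) //= lerDl.
by apply: sumr_ge0.
Qed.

Lemma weightC A k i j : weight A k j i = (weight A k i j)^*.
Proof. by rewrite /weight rmorphM /= conjcK mulrC. Qed.

Lemma Re_weight_ge0 A k i : 0 <= complex.Re (weight A k i i).
Proof.
by rewrite /weight; case: (spectralmx A k i) => x y /=; nra.
Qed.

Lemma norm_Re_weight A k i j :
  `|complex.Re (weight A k i j)| <=
  (complex.Re (weight A k i i) + complex.Re (weight A k j j)) / 2.
Proof.
rewrite /weight; case: (spectralmx A k i) => x y /=.
case: (spectralmx A k j) => z t /=; rewrite ler_norml; apply/andP; split.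
  by have := sqr_ge0 (x + z); have := sqr_ge0 (y + t); lra.
by have := sqr_ge0 (x - z); have := sqr_ge0 (y - t); lra.
Qed.

Lemma Re_hermfun f A i j : complex.Re (hermfun f A i j) =
  \sum_k f (eigval A k) * complex.Re (weight A k i j).
Proof.
rewrite hermfun_entry raddf_sum; apply: eq_bigr => k _.
by case: (weight A k i j) => x y /=; rewrite mul0r subr0.
Qed.

Lemma hermfunC f A i j : hermfun f A j i = (hermfun f A i j)^*.
Proof.
rewrite !hermfun_entry rmorph_sum; apply: eq_bigr => k _.
by rewrite weightC [RHS]rmorphM; congr (_ * _); apply/esym/conjc_real.
Qed.

Lemma ler_Re_hermfun f g A i : (forall k, f (eigval A k) <= g (eigval A k)) ->
  complex.Re (hermfun f A i i) <= complex.Re (hermfun g A i i).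
Proof.
move=> fg; rewrite [leLHS]Re_hermfun [leRHS]Re_hermfun; apply: ler_sum => k _.
by rewrite ler_wpM2r ?Re_weight_ge0.
Qed.

(** Each rank one weight satisfies this bound, and nonnegative combinations preserve it. It serves
    to control off-diagonal entries by diagonal ones. *)
Lemma norm_Re_hermfun f A i j : (forall k, 0 <= f (eigval A k)) ->
  `|complex.Re (hermfun f A i j)| <=
  (complex.Re (hermfun f A i i) + complex.Re (hermfun f A j j)) / 2.
Proof.
move=> f0; rewrite !Re_hermfun -big_split /= mulr_suml.
apply: le_trans (ler_norm_sum _ _ _) _; apply: ler_sum => k _.
rewrite normrM ger0_norm // -mulrDr -mulrA ler_wpM2l //.
exact: norm_Re_weight.
Qed.

(** Together with [ler_Re_hermfun], this turns a scalar quadratic bound on the eigenvalues into a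
    bound involving only entries of [A] and [A *m A]. *)
Lemma Re_hermfun_quadratic (x y z : R) A i : A \is hermsymmx ->
  complex.Re (hermfun (fun t => x + y * t + z * t ^+ 2) A i i) =
  x + y * complex.Re (A i i) + z * complex.Re ((A *m A) i i).
Proof.
move=> hA; pose S f := \sum_k f (eigval A k) * complex.Re (weight A k i i).
have SE f : S f = complex.Re (hermfun f A i i) by rewrite [RHS]Re_hermfun.
have E0 : S (fun=> 1) = 1 by rewrite SE hermfun1 mxE eqxx.
have E1 : S id = complex.Re (A i i) by rewrite SE hermfun_id.
have E2 : S (fun t => t * t) = complex.Re ((A *m A) i i).
  by rewrite SE -hermfunM hermfun_id.
transitivity (x * S (fun=> 1) + y * S id + z * S (fun t => t * t)).
  rewrite -SE /S !mulr_sumr -!big_split /=.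
  by apply: eq_bigr => k _; ring.
by rewrite E0 E1 E2 mulr1.
Qed.

End HermitianCalculus.

(** * First-order expansion of the power of a perturbed diagonal matrix *)

Section FirstOrder.
Variable R : realType.
Implicit Types (g h : R -> R) (k l : nat).

(* [h t = O(t ^ k)] as [t] tends to [0], with a bound uniform on [-1, 1]. *)
Definition bigO k h :=
  exists K : R, forall t, `|t| <= 1 -> `|h t| <= K * `|t| ^+ k.

Lemma bigO_eq k g h : bigO k g -> g =1 h -> bigO k h.
Proof. by move=> [K gK] gh; exists K => t t1; rewrite -gh; apply: gK. Qed.

Lemma bigO_le k g h : bigO k g -> (forall t, `|t| <= 1 -> `|h t| <= g t) ->
  bigO k h.
Proof.
move=> [K gK] hg; exists K => t t1; apply: le_trans (gK t t1).
exact: le_trans (hg t t1) (ler_norm _).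
Qed.

Lemma bigO_cst (c : R) : bigO 0 (fun=> c).
Proof. by exists `|c| => t _; rewrite expr0 mulr1. Qed.

Lemma bigO_id : bigO 1 id.
Proof. by exists 1 => t _; rewrite mul1r expr1. Qed.

Lemma bigOD k g h : bigO k g -> bigO k h -> bigO k (fun t => g t + h t).
Proof.
move=> [K gK] [L hL]; exists (K + L) => t t1; rewrite mulrDl.
by apply: le_trans (ler_normD _ _) _; apply: lerD; auto.
Qed.

Lemma bigON k h : bigO k h -> bigO k (fun t => - h t).
Proof. by move=> [K hK]; exists K => t t1; rewrite normrN; apply: hK. Qed.

Lemma bigOB k g h : bigO k g -> bigO k h -> bigO k (fun t => g t - h t).
Proof. by move=> gO /bigON; apply: bigOD. Qed.

Lemma bigOM k l g h : bigO k g -> bigO l h -> bigO (k + l) (fun t => g t * h t).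
Proof.
move=> [K gK] [L hL]; exists (K * L) => t t1.
by rewrite normrM exprD mulrACA; apply: ler_pM; auto.
Qed.

Lemma bigOZ k (c : R) h : bigO k h -> bigO k (fun t => c * h t).
Proof. exact: bigOM (bigO_cst c). Qed.

Lemma bigO_weaken k l h : (l <= k)%N -> bigO k h -> bigO l h.
Proof.
move=> lk [K hK]; exists K => t t1; apply: le_trans (hK t t1) _.
(* The sign of the constant comes from evaluating the bound at [t = 1]. *)
have K0 : 0 <= K.
  have := hK 1; rewrite normr1 expr1n mulr1 => /(_ (lexx 1)).
  exact: le_trans.
by rewrite ler_wpM2l // ler_wiXn2l.
Qed.

Lemma bigO_sum k (I : finType) (h : I -> R -> R) : (forall i, bigO k (h i)) ->
  bigO k (fun t => \sum_i h i t).
Proof.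
move=> hO; pose K i := projT1 (cid (hO i)).
have KP i t : `|t| <= 1 -> `|h i t| <= K i * `|t| ^+ k.
  by rewrite /K; case: cid => L /= HL; apply: HL.
exists (\sum_i K i) => t t1; rewrite mulr_suml.
by apply: le_trans (ler_norm_sum _ _ _) _; apply: ler_sum => i _; apply: KP.
Qed.

Variables (n : nat) (s : R) (b : 'I_n -> R) (E F : 'M[R]_n).
Hypotheses (s_gt2 : 2 < s) (b_gt0 : forall i, 0 < b i) (b_inj : injective b).

Let C t : 'M[R]_n := diag_mx (\row_i b i) + t *: E + t ^+ 2 *: F.
Let CC t : 'M[R[i]]_n := map_mx (real_complex R) (C t).

Hypotheses (C_herm : forall t, CC t \is hermsymmx)
  (C_psd : forall t (u : 'cV[R[i]]_n), 0 <= (u ^t* *m CC t *m u) 0 0).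

Let G t i j := complex.Re (hermpow (CC t) s i j).
Let D t i j := E i j + t * F i j.

Let CE t i j : C t i j = b i *+ (i == j) + t * D t i j.
Proof.
by rewrite /C /D !mxE; case: eqVneq => [->|_]; rewrite ?mulr1n ?mulr0n; ring.
Qed.

Let D_O i j : bigO 0 (fun t => D t i j).
Proof.
apply: bigOD; first exact: bigO_cst.
by apply: (@bigO_weaken 1) => //; apply: (bigOM bigO_id (bigO_cst _)).
Qed.

(** Dominates the trace of [C t] for |t| <= 1, hence each of its nonnegative eigenvalues. *)
Let bound : R := \sum_i (b i + `|E i i| + `|F i i|).

Let bound_ge i : b i <= bound.
Proof.
rewrite /bound (bigD1 i) //= -!addrA lerDl; apply: addr_ge0 => //.
by rewrite addr_ge0 // sumr_ge0 // => j _; rewrite !addr_ge0 // ltW.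
Qed.

Let eigval_bound t (k : 'I_n) : `|t| <= 1 -> 0 <= eigval (CC t) k <= bound.
Proof.
move=> t1; have e0 (l : 'I_n) : 0 <= eigval (CC t) l by apply: eigval_ge0.
rewrite e0; apply: le_trans (eigval_le_tr _ _ _) _ => //.
rewrite /mxtrace raddf_sum; apply: ler_sum => i _.
rewrite mxE /= CE eqxx mulr1n -addrA lerD2l.
apply: le_trans (ler_norm _) _; rewrite /D mulrDr.
apply: le_trans (ler_normD _ _) _; rewrite !normrM; apply: lerD.
  by rewrite ler_piMl.
by rewrite mulrA ler_piMl // mulr_ile1.
Qed.

Let CC_diag t i : complex.Re (CC t i i) = b i + t * D t i i.
Proof. by rewrite mxE /= CE eqxx. Qed.

Let CC_sqr_diag t i : complex.Re ((CC t *m CC t) i i) =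
  b i ^+ 2 + 2 * b i * (t * D t i i) + t ^+ 2 * \sum_j D t i j * D t j i.
Proof.
rewrite -map_mxM mxE /= mxE (bigD1 i) //= [in RHS](bigD1 i) //=.
rewrite !CE eqxx mulr1n [t ^+ 2 * _]mulrDr mulr_sumr.
under eq_bigr => j ji.
  rewrite !CE (negbTE ji) eq_sym (negbTE ji) !mulr0n !add0r.
  rewrite mulrACA -expr2.
  over.
by rewrite addrA; congr (_ + _); ring.
Qed.

(** Row [i] of [C t - b_i] is [t] times row [i] of [D t], so the diagonal entry [i] of
    [(C t - b_i)^2] is O(t^2). This entry is the spectral average of the quadratic error in the
    scalar tangent bounds. *)
Let G_diag i : bigO 2 (fun t =>
  G t i i - b i `^ s - t * (s * b i `^ (s - 1) * E i i)).
Proof.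
pose z := s * (s - 1) * bound `^ (s - 2).
have B0 := b_gt0 i.
suff : bigO 2 (fun t =>
    G t i i - b i `^ s - t * (s * b i `^ (s - 1) * D t i i)).
  have FO := bigOM (bigOM bigO_id bigO_id)
    (bigO_cst (s * b i `^ (s - 1) * F i i)).
  by move=> /bigOD/(_ FO) /bigO_eq; apply => t; rewrite /= /D; ring.
apply: (@bigO_le _ (fun t => z * (t * t * \sum_j D t i j * D t j i))).
  apply: bigOZ; apply: (bigOM (bigOM bigO_id bigO_id) (bigO_sum _)) => j.
  exact: (bigOM (D_O _ _) (D_O _ _)).
move=> t t1; rewrite ger0_norm.
(* [x], [y], [z] are the coefficients of the upper tangent parabola at [b i], expanded in powers of
   the eigenvalue. *)
- pose y := s * b i `^ (s - 1) - 2 * z * b i.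
  pose x := b i `^ s - s * b i `^ (s - 1) * b i + z * b i ^+ 2.
  have : G t i i <= x + y * complex.Re (CC t i i)
      + z * complex.Re ((CC t *m CC t) i i).
    rewrite -(Re_hermfun_quadratic x y z i (C_herm t)).
    apply: ler_Re_hermfun => k.
    have /andP[k0 k1] := eigval_bound k t1.
    have := @powR_le_tangent R s (b i) bound (eigval (CC t) k) s_gt2.
    rewrite ltW // bound_ge k0 k1 => /(_ isT isT).
    by rewrite /x /y -/z; lra.
  by rewrite CC_diag CC_sqr_diag /x /y; lra.
- pose y := s * b i `^ (s - 1).
  have : b i `^ s - y * b i + y * complex.Re (CC t i i)
      + 0 * complex.Re ((CC t *m CC t) i i) <= G t i i.
    rewrite -(Re_hermfun_quadratic _ _ _ i (C_herm t)).
    apply: ler_Re_hermfun => k.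
    have /andP[k0 k1] := eigval_bound k t1.
    have s1 : 1 < s by apply: lt_trans s_gt2; rewrite ltr1n.
    have := powR_ge_tangent s1 (ltW B0) k0.
    by rewrite -/y; lra.
  by rewrite CC_diag -/y; lra.
Qed.

Let G_bounded i j : bigO 0 (fun t => G t i j).
Proof.
have diagO (l : 'I_n) : bigO 0 (fun t => G t l l).
  have := bigOD (bigO_weaken (leq0n 2) (G_diag l))
    (bigOD (bigO_cst (b l `^ s)) (bigO_weaken (leq0n 1)
      (bigOM bigO_id (bigO_cst (s * b l `^ (s - 1) * E l l))))).
  by move=> /bigO_eq; apply => t; rewrite /=; ring.
apply: bigO_le (bigOZ 2^-1 (bigOD (diagO i) (diagO j))) _ => t _.
by rewrite mulrC; apply: norm_Re_hermfun => k; apply: powR_ge0.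
Qed.

(** Entry [(i, j)] of the commutation of [C t] with its power, the diagonal part [b] being moved to
    the left. *)
Let G_commute t i j : (b i - b j) * G t i j =
  t * \sum_k (G t i k * D t k j - D t i k * G t k j).
Proof.
have : hermpow (CC t) s *m CC t = CC t *m hermpow (CC t) s.
  transitivity (hermpow (CC t) s *m hermfun id (CC t)).
    by rewrite (hermfun_id (C_herm t)).
  transitivity (hermfun id (CC t) *m hermpow (CC t) s); last first.
    by rewrite (hermfun_id (C_herm t)).
  rewrite [LHS]hermfunM [RHS]hermfunM; congr hermfun.
  by apply/funext => x; rewrite mulrC.
move=> /(congr1 (fun X : 'M_n => complex.Re (X i j))).
rewrite !mxE !raddf_sum /=.
have ReM (z : R[i]) (x : R) : complex.Re (z * x%:C) = complex.Re z * x.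
  by case: z => ? ? /=; ring.
under eq_bigr => k _ do rewrite [CC t _ _]mxE ReM CE mulrDr.
under [in RHS]eq_bigr => k _ do rewrite [CC t _ _]mxE mulrC ReM CE mulrDr.
rewrite !big_split /= (bigD1 j) //= eqxx big1 ?addr0; last first.
  by move=> k /negbTE ->; rewrite mulr0n mulr0.
rewrite [in RHS](bigD1 i) //= eqxx [in RHS]big1 ?addr0; last first.
  by move=> k; rewrite eq_sym => /negbTE ->; rewrite mulr0n mulr0.
rewrite !mulr1n -!/(G _ _ _) => H.
rewrite sumrN mulrBr !mulr_sumr mulrBl.
have e1 : \sum_k t * (G t i k * D t k j) = \sum_k G t i k * (t * D t k j).
  by apply: eq_bigr => k _; ring.
have e2 : \sum_k t * (D t i k * G t k j) = \sum_k G t k j * (t * D t i k).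
  by apply: eq_bigr => k _; ring.
by rewrite e1 e2; move: H; rewrite /G; lra.
Qed.

(** The Loewner matrix of the power [s] at the points [b], with the derivative on the diagonal. *)
Definition divided_difference i j : R :=
  if i == j then s * b i `^ (s - 1) else (b i `^ s - b j `^ s) / (b i - b j).

(** Off the diagonal, [G_commute] is used twice, each use gaining a factor [t]: bounded entries give
    off-diagonal entries O(t), and then [G] is known up to O(t), which determines the off-diagonal
    entries up to O(t^2). *)
Lemma hermpow_first_order i j : bigO 2 (fun t =>
  complex.Re (hermpow (CC t) s i j) - b i `^ s *+ (i == j) - t * (divided_difference i j * E i j)).
Proof.
rewrite -/(G _ _ _); rewrite /divided_difference.
have [<-|ij] := eqVneq i j; first exact: G_diag.
have bij (k l : 'I_n) : k != l -> b k - b l != 0.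
  by rewrite subr_eq0; apply: contra => /eqP /b_inj ->.
have off (k l : 'I_n) : k != l -> bigO 1 (fun t => G t k l).
  move=> kl; apply: (@bigO_eq _ (fun t => (b k - b l)^-1 *
      (t * \sum_m (G t k m * D t m l - D t k m * G t m l)))).
    apply/bigOZ/(bigOM bigO_id)/bigO_sum => m.
    by apply: bigOB; apply: (bigOM (k:=0) (l:=0)).
  by move=> t; rewrite -G_commute mulKf // bij.
have diag (k : 'I_n) : bigO 1 (fun t => G t k k - b k `^ s).
  have := bigOD (bigO_weaken (leqnSn 1) (G_diag k))
     (bigOM bigO_id (bigO_cst (s * b k `^ (s - 1) * E k k))).
  by move=> /bigO_eq; apply => t; rewrite /=; ring.
(* The commutator sum with [G] replaced by [G - diag (b^s)], all of whose entries are O(t). The part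
   removed is [(b_i^s - b_j^s) D_ij], the source of the divided difference. *)
pose S t := \sum_(m : 'I_n) ((G t i m - b i `^ s *+ (i == m)) * D t m j
  - D t i m * (G t m j - b j `^ s *+ (m == j))).
have S_O : bigO 1 S.
  apply: bigO_sum => m; apply: bigOB.
    apply: (bigOM (k:=1) (l:=0)) => //; case: eqVneq => [<-|im].
      by rewrite mulr1n.
    by apply: bigO_eq (off _ _ im) _ => t; rewrite mulr0n subr0.
  apply: (bigOM (k:=0) (l:=1)) => //; case: eqVneq => [->|mj].
    by rewrite mulr1n.
  by apply: bigO_eq (off _ _ mj) _ => t; rewrite mulr0n subr0.
have FO := bigOM (bigOM bigO_id bigO_id)
  (bigO_cst ((b i `^ s - b j `^ s) * F i j)).
have := bigOZ (b i - b j)^-1 (bigOD (bigOM bigO_id S_O) FO).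
move=> /bigO_eq; apply => t; rewrite mulr0n subr0 /=.
have SE : S t = \sum_m (G t i m * D t m j - D t i m * G t m j)
    - (b i `^ s - b j `^ s) * D t i j.
  rewrite (_ : (b i `^ s - b j `^ s) * D t i j =
    \sum_m (b i `^ s *+ (i == m) * D t m j - D t i m * (b j `^ s *+ (m == j)))).
    by rewrite -sumrB; apply: eq_bigr => m _; ring.
  rewrite sumrB (bigD1 i) //= eqxx big1 ?addr0; last first.
    by move=> m; rewrite eq_sym => /negbTE ->; rewrite mulr0n mul0r.
  rewrite (bigD1 j) //= eqxx big1 ?addr0; last first.
    by move=> m /negbTE ->; rewrite mulr0n mulr0.
  by rewrite !mulr1n; ring.
rewrite SE mulrBr -G_commute /D; field; exact: bij.
Qed.

End FirstOrder.

(** * The power gap kernel is not conditionally negative *)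

Section PowerGap.
Variables (R : realType) (s : R).

Definition power_gap (x y : R) : R :=
  s * (x `^ s + y `^ s) - (x + y) * ((x `^ s - y `^ s) / (x - y)).

(* With [Y = c ^ (s / 2)], the gap between 1/2 and [c] exceeds the gap between
   1 and [c] by at least [Y ^ 2 / c - O(1)], while the latter is [O(Y ^ 2)]. The
   optimal weights are in the ratio [Y], and [Y / c] is unbounded as [s > 2]. *)
Lemma power_gap_not_conditionally_negative : 2 < s ->
  exists c p q : R, [/\ 1 < c, 0 < p, 0 < q, p + q = 1 &
    p * power_gap 2^-1 1 + q * power_gap 1 c < p * q * power_gap 2^-1 c].
Proof.
move=> s2.
(* The exponent in [c] gives [Y = c * w], so [w] prescribes the ratio [Y / c]. The value [7 s + 4]
   leaves the factor [3 s (Y - 1) + 4 (Y - 1) + 1] in the final estimate. *)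
pose w := 7 * s + 4; pose c := w `^ (2 / (s - 2)); pose Y := c `^ (s / 2).
have s0 : 0 < s by lra.
have w1 : 1 < w by rewrite /w; lra.
have gt1_powR (x y : R) : 1 < x -> 0 < y -> 1 < x `^ y.
  move=> x1 y0; have := @gt0_ltr_powR R y y0 1 x.
  by rewrite powR1; apply => //; rewrite nnegrE; lra.
have c1 : 1 < c by apply: gt1_powR => //; apply: divr_gt0; lra.
have Y1 : 1 < Y by apply: gt1_powR => //; lra.
have YE : Y = c * w.
  have -> : w = c `^ ((s - 2) / 2).
    rewrite /c -powRrM (_ : _ * _ = 1) ?powRr1 //; first lra.
    by field; lra.
  have c0 : 0 <= c by lra.
  rewrite -[X in _ = X * _](powRr1 c0) /Y -powRD.
    by congr (_ `^ _); field.
  by apply/implyP => _; lra.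
have csE : c `^ s = Y ^+ 2.
  have sE : s = s / 2 * 2 by field.
  by rewrite {1}sE powRrM powR_mulrn ?powR_ge0.
pose d : R := 2^-1 `^ s.
have d0 : 0 < d by apply: powR_gt0; lra.
have d1 : d < 1.
  have := @gt0_ltr_powR R s s0 2^-1 1.
  by rewrite powR1; apply; rewrite ?nnegrE; lra.
have k12 : power_gap 2^-1 1 <= 2 * s.
  rewrite /power_gap -/d powR1.
  have -> : (2^-1 + 1) * ((d - 1) / (2^-1 - 1)) = 3 * (1 - d) by field.
  have : 0 < s * (1 - d) by apply: mulr_gt0; lra.
  by lra.
have c10 : (1 - c)^-1 < 0 by rewrite invr_lt0; lra.
have k23 : power_gap 1 c <= 2 * s * Y ^+ 2.
  rewrite /power_gap csE powR1.
  have : 0 <= (1 + c) * ((1 - Y ^+ 2) / (1 - c)).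
    by apply: mulr_ge0; [lra|apply: mulr_le0; [nra|lra]].
  have : 0 < s * (Y ^+ 2 - 1) by apply: mulr_gt0 => //; nra.
  by lra.
have k13 : w * Y - s - 3 <= power_gap 2^-1 c - power_gap 1 c.
  have -> : w * Y = Y ^+ 2 / c by rewrite expr2 {2}YE; field; lra.
  rewrite /power_gap csE powR1 -/d.
  have cV1 : c^-1 < 1 by rewrite invf_lt1; lra.
  have cV0 : 0 < c^-1 by rewrite invr_gt0; lra.
  (* The terms of order [Y^2] are split off and cancel in the difference of the gaps. There remains
     [2 (Y^2 - 1) / (c - 1) - (Y^2 - d) / (c - 1/2)], at least [Y^2 / c - 2], up to bounded
     terms. *)
  have -> : (2^-1 + c) * ((d - Y ^+ 2) / (2^-1 - c)) =
      (Y ^+ 2 - d) + (Y ^+ 2 - d) / (c - 2^-1) by field; lra.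
  have -> : (1 + c) * ((1 - Y ^+ 2) / (1 - c)) =
      (Y ^+ 2 - 1) + 2 * ((Y ^+ 2 - 1) / (c - 1)) by field; lra.
  have h1 : (Y ^+ 2 - 1) / (c - 2^-1) <= (Y ^+ 2 - 1) / (c - 1).
    by rewrite ler_wpM2l ?lef_pV2 ?posrE; nra.
  have h2 : (Y ^+ 2 - 2) / c <= (2 * Y ^+ 2 - 2 - (Y ^+ 2 - d)) / (c - 2^-1).
    have Y2 : 2 < Y ^+ 2 by rewrite YE /w; nra.
    apply: (@le_trans _ _ ((Y ^+ 2 - 2) / (c - 2^-1))).
      by rewrite ler_wpM2l ?lef_pV2 ?posrE; lra.
    by rewrite ler_wpM2r ?invr_ge0; lra.
  have h3 : (2 * Y ^+ 2 - 2 - (Y ^+ 2 - d)) / (c - 2^-1) =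
    2 * ((Y ^+ 2 - 1) / (c - 2^-1)) - (Y ^+ 2 - d) / (c - 2^-1) by ring.
  have h4 : s * d > 0 by apply: mulr_gt0.
  have h5 : Y ^+ 2 / c - 2 <= (Y ^+ 2 - 2) / c by rewrite mulrBl; lra.
  by lra.
exists c, (Y / (1 + Y)), (1 + Y)^-1; split => //.
- by apply: divr_gt0; lra.
- by rewrite invr_gt0; lra.
- by field; lra.
rewrite -subr_gt0.
have -> : Y / (1 + Y) * (1 + Y)^-1 * power_gap 2^-1 c -
    (Y / (1 + Y) * power_gap 2^-1 1 + (1 + Y)^-1 * power_gap 1 c) =
  (Y * (power_gap 2^-1 c - power_gap 1 c - power_gap 2^-1 1)
    - Y ^+ 2 * power_gap 2^-1 1 - power_gap 1 c) / (1 + Y) ^+ 2.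
  by field; lra.
apply: divr_gt0; last by apply: exprn_gt0; lra.
move: k12 k23 k13; set k := power_gap 2^-1 c - _.
move: (power_gap 2^-1 1) (power_gap 1 c) k => x y k xs ys kw.
have t1 : Y * (w * Y - s - 3 - 2 * s) <= Y * (k - x) by rewrite ler_pM2l; lra.
have t2 : Y ^+ 2 * x <= Y ^+ 2 * (2 * s) by rewrite ler_pM2l ?exprn_gt0; lra.
have : 0 < Y * (3 * s * (Y - 1) + 4 * (Y - 1) + 1).
  have : 0 < s * (Y - 1) by apply: mulr_gt0; lra.
  by move=> ?; apply: mulr_gt0; lra.
by rewrite /w in t1; lra.
Qed.

End PowerGap.

(** * Positive definiteness, traces against a real vector, and a sign lemma *)

Section RealMatrices.
Variable R : realType.
Implicit Types n : nat.

Lemma trmxC_real n m (M : 'M[R]_(m, n)) :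
  (map_mx (real_complex R) M) ^t* = map_mx (real_complex R) M^T.
Proof. by apply/matrixP => i j; rewrite !mxE; apply: conjc_real. Qed.

Lemma map_diag_row n (d : 'rV[R]_n) :
  diag_mx (\row_j (d 0 j)%:C) = map_mx (real_complex R) (diag_mx d).
Proof.
by rewrite map_diag_mx; congr diag_mx; apply/rowP => j; rewrite !mxE.
Qed.

Lemma diag_formE n (d : 'I_n -> R) (y : 'cV[R[i]]_n) :
  (y ^t* *m diag_mx (\row_i (d i)%:C) *m y) 0 0 =
  \sum_i (d i)%:C * `|y i 0| ^+ 2.
Proof.
rewrite mul_mx_diag mxE; apply: eq_bigr => i _.
by rewrite !mxE sqr_normc mulrAC mulrC; congr (_ * _); rewrite mulrC.
Qed.

Lemma posdef_unitary_diag n (U : 'M[R[i]]_n) (d : 'I_n -> R) :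
  U \is unitarymx -> (forall i, 0 < d i) ->
  posdefmx (U ^t* *m diag_mx (\row_i (d i)%:C) *m U).
Proof.
move=> Uu d0; split.
  apply/is_hermitianmxP; rewrite expr0 scale1r !trmx_mul !map_mxM /= trmxCK.
  have -> : (diag_mx (\row_i (d i)%:C)) ^t* = diag_mx (\row_i (d i)%:C).
    rewrite tr_diag_mx map_diag_mx; congr diag_mx.
    by apply/rowP => j; rewrite !mxE; apply: conjc_real.
  by rewrite mulmxA.
move=> u u0; set y := U *m u.
have -> : u ^t* *m (U ^t* *m diag_mx (\row_i (d i)%:C) *m U) *m u =
    y ^t* *m diag_mx (\row_i (d i)%:C) *m y.
  by rewrite /y trmx_mul map_mxM /= !mulmxA.
have [i yi] : exists i, y i 0 != 0.
  apply/existsP; apply: contraNT u0; rewrite negb_exists => /forallP y0.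
  have yE : y = 0.
    apply/colP => i; rewrite [RHS]mxE; apply/eqP.
    by have := y0 i; rewrite negbK.
  have := congr1 (fun z => U ^t* *m z) yE; rewrite /y mulmxA mulmx0.
  by rewrite (mulmx1C (unitarymxP Uu)) mul1mx => ->.
rewrite diag_formE (bigD1 i) //=; apply: ltr_pwDl.
  by apply: mulr_gt0; rewrite ?ltcR // exprn_gt0 // normr_gt0.
by apply: sumr_ge0 => j _; apply: mulr_ge0; [rewrite lecR ltW|apply: exprn_ge0].
Qed.

Lemma spec_posdef n (A : 'M[R[i]]_n) : posdefmx A ->
  spec A `<=` [set x%:C | x in [set` `]0, +oo[%R : interval R]].
Proof.
move=> [hA pA] z /eigenvalueP[v vA v0].
(* [eigenvalue] refers to row vectors, so positivity is tested on the column [v ^t*]. *)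
have w0 : v ^t* != 0.
  by apply: contraNneq v0 => H; rewrite -[v]trmxCK H trmx0 map_mx0.
have := pA _ w0; rewrite trmxCK vA -scalemxAl mxE.
have vv : 0 < (v *m v ^t*) 0 0.
  have /rV0Pn[j vj] := v0.
  rewrite mxE (bigD1 j) //=; apply: ltr_pwDl.
    by rewrite !mxE -sqr_normc exprn_gt0 // normr_gt0.
  by apply: sumr_ge0 => k _; rewrite !mxE -sqr_normc exprn_ge0.
rewrite pmulr_lgt0 // => z0; exists (complex.Re z).
  by move: z0; rewrite ltcE /= in_itv /= andbT => /andP[].
by rewrite RRe_real // ger0_real // ltW.
Qed.

(** Swapping the indices shows that the sum is its own conjugate. Comparing traces in [R[i]] thus
    reduces to comparing reals. *)
Lemma hermfun_form n (v : 'rV[R]_n) f (Z : 'M[R[i]]_n) :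
  \sum_i \sum_j (v 0 i * v 0 j)%:C * hermfun f Z i j =
  (\sum_i \sum_j v 0 i * v 0 j * complex.Re (hermfun f Z i j))%:C.
Proof.
set z := LHS.
have zr : z \is Num.real.
  apply/CrealP; rewrite /z rmorph_sum /= exchange_big; apply: eq_bigr => i _.
  rewrite rmorph_sum; apply: eq_bigr => j _.
  rewrite rmorphM (hermfunC f Z i j) [v 0 j * _]mulrC; congr (_ * _).
  exact: conjc_real.
rewrite -(RRe_real zr) /z raddf_sum; congr (_%:C); apply: eq_bigr => i _.
rewrite raddf_sum; apply: eq_bigr => j _.
by case: (hermfun f Z i j) => ? ? /=; ring.
Qed.

(** The diagonal factor selects the rank one projection onto row 0 of [O], so the trace is the
    quadratic form of [X] at that row. *)
Lemma tr_projection n (O : 'M[R]_n.+1) (X : 'M[R[i]]_n.+1) (e : 'rV[R]_n.+1) :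
  (forall i, e 0 i = (i == 0)%:R) ->
  \tr ((map_mx (real_complex R) O) ^t* *m diag_mx (\row_i (e 0 i)%:C) *m
    map_mx (real_complex R) O *m X) =
  \sum_i \sum_j (row 0 O 0 i * row 0 O 0 j)%:C * X i j.
Proof.
move=> e1; rewrite /mxtrace [RHS]exchange_big; apply: eq_bigr => j _.
rewrite mxE; apply: eq_bigr => i _; rewrite mxE (bigD1 0) //= big1 ?addr0.
  rewrite mul_mx_diag trmxC_real !mxE e1 mulr1 -rmorphM /=.
  by rewrite [O 0 j * _]mulrC.
by move=> k k0; rewrite mul_mx_diag !mxE e1 (negbTE k0) mulr0 mul0r.
Qed.

Lemma first_order_sign (h : R -> R) (x y : R) : y < 0 ->
  bigO 2 (fun t => h t - x - t * y) ->
  exists t : R, [/\ 0 < t, t < 1, h t < x & x < h (- t)].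
Proof.
(* This [t] lies in (0, 1) and satisfies [t * M < - y], so the linear term beats the remainder at
   both [t] and [- t]. *)
move=> y0 [K hK]; pose M : R := `|K| + 1; pose t : R := - y / (M - y).
have M1 : 1 <= M by rewrite lerDr.
have t0 : 0 < t by apply: divr_gt0; lra.
have t1 : t < 1 by rewrite /t ltr_pdivrMr; lra.
have tM : t * M < - y.
  have yy : 0 < y * y by rewrite nmulr_rgt0.
  by rewrite /t mulrAC ltr_pdivrMr; lra.
have KM : K * t ^+ 2 < - y * t.
  have : K * (t * t) <= M * (t * t).
    have tt : 0 < t * t by apply: mulr_gt0.
    by rewrite (ler_pM2r tt) /M; have := ler_norm K; lra.
  have : t * M * t < - y * t by rewrite ltr_pM2r.
  by rewrite expr2; lra.
exists t; split => //.
  have := hK t; rewrite gtr0_norm // => /(_ (ltW t1)).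
  by rewrite ler_norml => /andP[_]; lra.
have := hK (- t); rewrite normrN gtr0_norm // => /(_ (ltW t1)).
by rewrite ler_norml => /andP[]; lra.
Qed.

End RealMatrices.

(** * Both trace inequalities fail when the first variation is negative *)

Section Perturbation.
Variables (R : realType) (n : nat) (s : R).
Variables (O : 'M[R]_n.+1) (h b : 'rV[R]_n.+1).

Let H : 'M[R]_n.+1 := O^T *m diag_mx h *m O.

(** The derivative at 0 of the quadratic form of [C^s] at row 0 of [O]; [H_ij (b_i + b_j)] is the
    entry of [H B + B H], the linear coefficient of [C]. *)
Definition first_variation : R := \sum_i \sum_j O 0 i * O 0 j *
  (divided_difference s (b 0) i j * (H i j * (b 0 i + b 0 j))).

Hypotheses (s_gt2 : 2 < s) (O_orth : O *m O^T = 1%:M)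
  (h0 : h 0 0 = 0) (h_gt0 : forall i, i != 0 -> 0 < h 0 i)
  (h_le1 : forall i, h 0 i <= 1)
  (b_gt0 : forall i, 0 < b 0 i) (b_inj : injective (b 0)).

Local Notation toC := (map_mx (real_complex R)).

Let U := toC O.
Let a t : 'rV[R]_n.+1 := \row_i (1 + t * h 0 i) ^+ 2.
Let A t := U ^t* *m diag_mx (\row_i (a t 0 i)%:C) *m U.
Let B := diag_mx (\row_i (b 0 i)%:C).
Let S t : 'M[R]_n.+1 := 1%:M + t *: H.

Let U_unitary : U \is unitarymx.
Proof. by apply/unitarymxP; rewrite trmxC_real -map_mxM O_orth map_mx1. Qed.

Let root_gt0 t i : `|t| < 1 -> 0 < 1 + t * h 0 i.
Proof.
rewrite ltr_norml => /andP[t1 t2]; have h1 := h_le1 i.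
have [->|/h_gt0 hi] := eqVneq i 0; first by rewrite h0 mulr0 addr0.
by nra.
Qed.

Let hermfun_A f t : hermfun f (A t) =
  U ^t* *m diag_mx (\row_i (f (a t 0 i))%:C) *m U.
Proof. exact: hermfunE. Qed.

Let A_posdef t : `|t| < 1 -> posdefmx (A t).
Proof.
move=> t1; apply: posdef_unitary_diag => // i.
by rewrite mxE exprn_gt0 // root_gt0.
Qed.

Let BE : (1%:M : 'M[R[i]]_n.+1) ^t* *m B *m 1%:M = B.
Proof. by rewrite trmx1 map_mx1 mul1mx mulmx1. Qed.

Let one_unitary : (1%:M : 'M[R[i]]_n.+1) \is unitarymx.
Proof. by apply/unitarymxP; rewrite trmx1 map_mx1 mul1mx. Qed.

Let hermfun_B f : hermfun f B = diag_mx (\row_i (f (b 0 i))%:C).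
Proof.
rewrite -[in LHS]BE (hermfunE f b one_unitary).
by rewrite trmx1 map_mx1 mul1mx mulmx1.
Qed.

Let B_posdef : posdefmx B.
Proof. by rewrite -BE; apply: posdef_unitary_diag. Qed.

Let H_sym : H^T = H.
Proof. by rewrite /H !trmx_mul trmxK tr_diag_mx mulmxA. Qed.

Let S_herm t : (toC (S t)) ^t* = toC (S t).
Proof.
by rewrite trmxC_real /S linearD linearZ /= trmx1 -/H H_sym.
Qed.

Let A_sqrt t : `|t| < 1 -> hermpow (A t) (1 / 2) = toC (S t).
Proof.
move=> t1; rewrite /hermpow hermfun_A.
have -> : toC (S t) = U ^t* *m toC (diag_mx (\row_i (1 + t * h 0 i))) *m U.
  rewrite /U trmxC_real -!map_mxM; congr toC.
  have -> : diag_mx (\row_i (1 + t * h 0 i)) = 1%:M + t *: diag_mx h.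
    apply/matrixP => i j; rewrite !mxE; case: eqVneq => [->|_].
      by rewrite !mulr1n.
    by rewrite !mulr0n mulr0 addr0.
  rewrite mulmxDr mulmxDl mulmx1 (mulmx1C O_orth).
  by rewrite -scalemxAr -scalemxAl.
rewrite -map_diag_row.
suff -> : \row_i (a t 0 i `^ (1 / 2))%:C =
    \row_i ((\row_i (1 + t * h 0 i)) 0 i)%:C :> 'rV[R[i]]_n.+1 by [].
apply/rowP => i; rewrite !mxE.
(* Positivity makes the root of the square [1 + t h_i] itself and not merely its absolute value. *)
have r0 := root_gt0 i t1.
by rewrite div1r powR12_sqrt ?sqr_ge0 // sqrtr_sqr gtr0_norm.
Qed.

Let C t : 'M[R]_n.+1 := diag_mx (\row_i b 0 i)
  + t *: (H *m diag_mx b + diag_mx b *m H) + t ^+ 2 *: (H *m diag_mx b *m H).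

Let CE t : toC (C t) = toC (S t) *m B *m toC (S t).
Proof.
rewrite /B map_diag_row -!map_mxM; congr toC; rewrite /C /S.
have -> : \row_i b 0 i = b by apply/rowP => i; rewrite mxE.
rewrite mulmxDl mul1mx mulmxDr mulmx1 mulmxDl -!scalemxAl -!scalemxAr.
by rewrite scalerA -expr2 scalerDr !addrA.
Qed.

Let C_herm t : toC (C t) \is hermsymmx.
Proof.
apply/is_hermitianmxP; rewrite expr0 scale1r CE !trmx_mul !map_mxM /=.
by rewrite S_herm /B map_diag_row trmxC_real tr_diag_mx mulmxA.
Qed.

Let C_psd t (u : 'cV[R[i]]_n.+1) : 0 <= (u ^t* *m toC (C t) *m u) 0 0.
Proof.
rewrite CE; set y := toC (S t) *m u.
have -> : u ^t* *m (toC (S t) *m B *m toC (S t)) *m u = y ^t* *m B *m y.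
  by rewrite /y trmx_mul map_mxM /= S_herm !mulmxA.
rewrite diag_formE; apply: sumr_ge0 => j _.
by apply: mulr_ge0; [rewrite lecR ltW|apply: exprn_ge0].
Qed.

Let form (X : 'M[R[i]]_n.+1) : R :=
  \sum_i \sum_j O 0 i * O 0 j * complex.Re (X i j).

Let form_variation :
  bigO 2 (fun t => form (hermpow (toC (C t)) s) - form (hermpow B s)
    - t * first_variation).
Proof.
have entry i j := hermpow_first_order s_gt2 b_gt0 b_inj C_herm C_psd i j.
have := bigO_sum (fun i => bigO_sum (fun j =>
  bigOZ (O 0 i * O 0 j) (entry i j))).
move=> /bigO_eq; apply => t; rewrite /form /first_variation mulr_sumr -!sumrB.
apply: eq_bigr => i _; rewrite mulr_sumr -!sumrB; apply: eq_bigr => j _.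
have -> : complex.Re (hermpow B s i j) = b 0 i `^ s *+ (i == j).
  by rewrite /hermpow hermfun_B !mxE; case: eqVneq.
have -> X : (X *m diag_mx b + diag_mx b *m X) i j = X i j * (b 0 i + b 0 j).
  by rewrite mul_mx_diag mul_diag_mx !mxE mulrDr addrC [b 0 i * _]mulrC.
by ring.
Qed.

Let tr_form0 t f g Z : (forall i, f (a t 0 i) = (i == 0)%:R) ->
  \tr (hermfun f (A t) *m hermfun g Z) = (form (hermfun g Z))%:C.
Proof.
move=> fa; rewrite hermfun_A.
pose e := \row_j f (a t 0 j).
have eE i : e 0 i = (i == 0)%:R by rewrite mxE.
have := tr_projection O (hermfun g Z) eE.
rewrite hermfun_form => H1; rewrite -/U in H1.
have -> : \row_i (f (a t 0 i))%:C = \row_i (e 0 i)%:C :> 'rV[R[i]]_n.+1.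
  by apply/rowP => j; rewrite !mxE.
rewrite H1; congr (_%:C); apply: eq_bigr => i _; apply: eq_bigr => j _.
by rewrite !mxE.
Qed.

Let tr_form t f g Z : (forall i, f (a t 0 i) * a t 0 i `^ s = (i == 0)%:R) ->
  \tr (hermfun f (A t) *m hermpow (A t) s *m hermfun g Z)
    = (form (hermfun g Z))%:C.
Proof. by move=> fa; rewrite /hermpow hermfunM tr_form0. Qed.

Let a0 t : a t 0 0 = 1.
Proof. by rewrite mxE h0 mulr0 addr0 expr1n. Qed.

Lemma trace_inequalities_fail : first_variation < 0 ->
  (exists (A B : 'M[R[i]]_n.+1) (I : interval R) (f : R -> R),
    [/\ posdefmx A /\ posdefmx B,
        spec A `<=` [set x%:C | x in [set` I]],
        {in I, forall x, 0 <= f x},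
        {in I &, {homo f : x y / x <= y}} &
        \tr (hermfun f A *m hermpow A s *m hermpow B s) <
        \tr (hermfun f A *m
             hermpow (hermpow A (1 / 2) *m B *m hermpow A (1 / 2)) s)])
  /\
  (exists (A B : 'M[R[i]]_n.+1) (I : interval R) (g : R -> R),
    [/\ posdefmx A /\ posdefmx B,
        spec A `<=` [set x%:C | x in [set` I]] /\ {in I, forall x, 0 < x},
        {in I, forall x, 0 <= x `^ s * g x},
        {in I &, {homo (fun x => x `^ s * g x) : x y / x <= y >-> y <= x}} &
        \tr (hermfun g A *m
             hermpow (hermpow A (1 / 2) *m B *m hermpow A (1 / 2)) s) <
        \tr (hermfun g A *m hermpow A s *m hermpow B s)]).
Proof.
move=> /first_order_sign/(_ form_variation)[t [t0 t1 lt_t gt_t]].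
have nt : `|t| < 1 by rewrite gtr0_norm.
have nNt : `|- t| < 1 by rewrite normrN.
split.
(* At [- t] the eigenvalue of row 0 is 1 and all others are below 1, so this step function isolates
   row 0; as that eigenvalue is 1, the factor [A^s] changes nothing. *)
- pose f (x : R) : R := (1 <= x)%R%:R.
  have fa i : f (a (- t) 0 i) = (i == 0)%:R.
    have [->|i0] := eqVneq i 0; first by rewrite a0 /f lexx.
    rewrite /f mxE lt_geF // expr_lt1 //; last exact/ltW/root_gt0.
    by rewrite gtrDl mulNr oppr_lt0 mulr_gt0 ?h_gt0.
  exists (A (- t)), B, `]0, +oo[%R, f; split.
  + exact: (conj (A_posdef nNt) B_posdef).
  + exact: spec_posdef (A_posdef nNt).
  + by move=> x _; rewrite /f ler0n.
  + move=> x y _ _ xy; rewrite /f ler_nat.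
    by case: (leP 1 x) => // x1; rewrite (le_trans x1 xy).
  rewrite (A_sqrt nNt) -CE tr_form; last first.
    move=> i; rewrite fa; case: eqVneq => [->|_]; rewrite ?mul0r //.
    by rewrite a0 powR1 mulr1.
  by rewrite (tr_form0 _ _ fa) ltcR.
(* At [t] the other eigenvalues exceed 1, so the decreasing step [x^s g(x)] isolates row 0. *)
- pose g (x : R) : R := if x <= 1 then x `^ (- s) else 0.
  have gE x : 0 < x -> x `^ s * g x = (x <= 1)%R%:R.
    move=> x0; rewrite /g; case: leP => _; last by rewrite mulr0.
    by rewrite powRN mulfV // gt_eqF // powR_gt0.
  have ga i : g (a t 0 i) = (i == 0)%:R.
    have [->|i0] := eqVneq i 0; first by rewrite a0 /g lexx powR1.
    by rewrite /g mxE lt_geF // exprn_egt1 // ltrDl mulr_gt0 ?h_gt0.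
  exists (A t), B, `]0, +oo[%R, g; split.
  + exact: (conj (A_posdef nt) B_posdef).
  + split; first exact: spec_posdef (A_posdef nt).
    by move=> x; rewrite in_itv /= andbT.
  + by move=> x; rewrite in_itv /= andbT => x0; rewrite gE // ler0n.
  + move=> x y; rewrite !in_itv /= !andbT => x0 y0 xy; rewrite !gE // ler_nat.
    by case: (leP y 1) => // y1; rewrite (le_trans xy y1).
  rewrite (A_sqrt nt) -CE tr_form; last first.
    move=> i; rewrite ga; case: eqVneq => [->|_]; rewrite ?mul0r //.
    by rewrite a0 powR1 mulr1.
  by rewrite (tr_form0 _ _ ga) ltcR.
Qed.

End Perturbation.

(** * The explicit 3 by 3 data *)

Section Witness.
Variables (R : realType) (s c a e eta : R).

Definition witness_b : 'rV[R]_3 := \row_j [:: 2^-1; 1; c]`_j.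

(** A positive [eta] keeps the eigenvalue 1 of [A] simple. *)
Definition witness_h : 'rV[R]_3 := \row_j [:: 0; eta; 1]`_j.

(** The rows are [v], [w], [u]. The products [u_i v_i] are [a^2 / 2], [- 1 / 2], [e^2 / 2], with sum
    0 when [a^2 + e^2 = 1]. *)
Definition witness_O : 'M[R]_3 := \matrix_(i, j)
  (nth [::] [:: [:: Num.sqrt 2^-1 * a; Num.sqrt 2^-1; Num.sqrt 2^-1 * e];
                [:: e; 0; - a];
                [:: Num.sqrt 2^-1 * a; - Num.sqrt 2^-1; Num.sqrt 2^-1 * e]] i)`_j.

Hypothesis ae1 : a ^+ 2 + e ^+ 2 = 1.

Let r := Num.sqrt (2^-1 : R).

Let rr : r * r = 2^-1.
Proof. by rewrite -expr2 sqr_sqrtr // invr_ge0. Qed.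

Let aa : a * a = 1 - e * e.
Proof. by rewrite -!expr2 -ae1; ring. Qed.

Lemma witness_O_orth : witness_O *m witness_O^T = 1%:M.
Proof.
apply/matrixP => i j; rewrite !mxE !big_ord_recl big_ord0 !mxE -/r.
have raa : r * r * (a * a) = r * r * (1 - e * e) by rewrite aa.
case: i => [[|[|[|//]]] ?]; case: j => [[|[|[|//]]] ?] /=;
  rewrite ?(mulr1n, mulr0n); have := rr; have := aa; lra.
Qed.

(** The middle entry of [w] vanishes, so off the diagonal [eta] affects only the pair [(1/2, c)],
    where it scales the entry of [H] by [1 - 2 eta]. *)
Lemma first_variation_witness : 0 < s -> 1 < c ->
  first_variation s witness_O witness_h witness_b =
  (a ^+ 2 * power_gap s 2^-1 1 + e ^+ 2 * power_gap s 1 c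
   - (1 - 2 * eta) * (a ^+ 2 * e ^+ 2 * power_gap s 2^-1 c)) / 2.
Proof.
move=> s0 c1.
rewrite /first_variation mul_mx_diag /power_gap !big_ord_recl !big_ord0.
rewrite /divided_difference !mxE !big_ord_recl !big_ord0 !mxE /= -/r !powR1.
(* Divided differences at [(i, j)] and [(j, i)] are made identical and then abstracted, which leaves
   a polynomial identity modulo the relations [rr] and [aa]. *)
have swap (x y z t : R) : (x - y) / (z - t) = (y - x) / (t - z).
  by rewrite -[x - y]opprB -[z - t]opprB invrN mulrNN.
rewrite (swap _ (2^-1 `^ s) 1) (swap _ (2^-1 `^ s) c) (swap _ 1 c).
rewrite -(@mulr_powRB1 _ 2^-1 s) //; last by rewrite invr_ge0.
rewrite -(@mulr_powRB1 _ c s) //; last by apply: le_trans (ltW c1).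
move: (2^-1 `^ (s - 1)) (c `^ (s - 1)) => f g.
move: ((_ - 1) / (_ - 1)) ((_ - c * g) / (2^-1 - c)) ((_ - c * g) / (1 - c)).
move=> x y z.
transitivity ((r * r) * (
    (a * a) * (s * f * ((eta * (e * e) + r * r * (a * a)) * (2^-1 + 2^-1)))
  + s * (r * r) * 2
  + (e * e) * (s * g * ((eta * (a * a) + r * r * (e * e)) * (c + c)))
  - 2 * (a * a) * (r * r) * x * (2^-1 + 1)
  + 2 * (a * a) * (e * e) * (r * r - eta) * y * (2^-1 + c)
  - 2 * (e * e) * (r * r) * z * (1 + c))); first by ring.
by rewrite !expr2 !rr !aa; field.
Qed.

End Witness.

Theorem corollary2p3 (R : realType) (s : R) (hs : 2 < s) :
  (exists (A B : 'M[R[i]]_3) (I : interval R) (f : R -> R),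
    [/\ posdefmx A /\ posdefmx B,
        spec A `<=` [set x%:C | x in [set` I]],
        {in I, forall x, 0 <= f x},
        {in I &, {homo f : x y / x <= y}} &
        \tr (hermfun f A *m hermpow A s *m hermpow B s) <
        \tr (hermfun f A *m
             hermpow (hermpow A (1 / 2) *m B *m hermpow A (1 / 2)) s)])
  /\
  (exists (A B : 'M[R[i]]_3) (I : interval R) (g : R -> R),
    [/\ posdefmx A /\ posdefmx B,
        spec A `<=` [set x%:C | x in [set` I]] /\ {in I, forall x, 0 < x},
        {in I, forall x, 0 <= x `^ s * g x},
        {in I &, {homo (fun x => x `^ s * g x) : x y / x <= y >-> y <= x}} &
        \tr (hermfun g A *m
             hermpow (hermpow A (1 / 2) *m B *m hermpow A (1 / 2)) s) <
        \tr (hermfun g A *m hermpow A s *m hermpow B s)]).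
Proof.
have [c [p [q [c1 p0 q0 pq1 gap]]]] := power_gap_not_conditionally_negative hs.
pose L : R := p * power_gap s 2^-1 1 + q * power_gap s 1 c.
pose M : R := p * q * power_gap s 2^-1 c.
(* Chosen so that [0 < eta <= 1] and [L < (1 - 2 eta) M], which makes the first variation negative.
   The absolute values avoid any case on the sign of [M]. *)
pose eta : R := (M - L) / (2 * (`|M| + `|L| + 1)).
have LM : L < M by [].
have nM := ler_norm M; have nL := ler_norm (- L); rewrite normrN in nL.
have M0 := normr_ge0 M; have L0 := normr_ge0 L.
have eta0 : 0 < eta by apply: divr_gt0; lra.
have eta1 : eta <= 1 by rewrite ler_pdivrMr; lra.
have etaM : 2 * eta * M < M - L.
  apply: (@le_lt_trans _ _ (2 * eta * `|M|)); first by rewrite ler_pM2l //; lra.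
  have -> : 2 * eta * `|M| = (M - L) * (`|M| / (`|M| + `|L| + 1)).
    by rewrite /eta; field; lra.
  by rewrite gtr_pMr ?ltr_pdivrMr; lra.
have ae1 : Num.sqrt p ^+ 2 + Num.sqrt q ^+ 2 = 1.
  by rewrite !sqr_sqrtr // ltW.
have s0 : 0 < s by lra.
apply: (@trace_inequalities_fail R 2 s (witness_O (Num.sqrt p) (Num.sqrt q))
  (witness_h eta) (witness_b c)) => //.
- exact: witness_O_orth.
- by rewrite mxE.
- by case=> [[|[|[|//]]] ?] // _; rewrite mxE.
- by case=> [[|[|[|//]]] ?]; rewrite mxE /=; lra.
- by case=> [[|[|[|//]]] ?]; rewrite mxE /= ?invr_gt0; lra.
- by case=> [[|[|[|//]]] ?] [[|[|[|//]]] ?]; rewrite !mxE /= => H;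
    apply/val_inj => //=; exfalso; lra.
rewrite first_variation_witness // !sqr_sqrtr ?(ltW p0) ?(ltW q0) //.
rewrite -/L -/M; lra.
Qed.
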